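(* Let $X$ be a non-empty set and $A$ a non-empty subset of $X$, and let $P=\operatorname{Reg}(\mathcal T_X(A))$. Then $$\operatorname{rank}(P)=\begin{cases}1 & \text{if } |A|=1,\\ 2^{|X|} & \text{if } |A|\ge2 \text{ and } X \text{ is infinite},\\ 3 & \text{if } 3\le|A|=|X| \text{ is finite},\\ 1+|A|^{|X\setminus A|} & \text{otherwise}.\end{cases}$$
   Context: $\mathcal T_X(A)=\{f:X\to X\mid\operatorname{im}(f)\subseteq A\}$ under composition; $\operatorname{Reg}(T)$ is the set of regular elements of $T$, which here is a subsemigroup. $\operatorname{rank}(T)$ is the minimum cardinality of a generating set of the semigroup $T$. *)

(* Defs.v *)
From Stdlib Require Import List Arith.
Import ListNotations.

Definition in_TXA {X : Type} (A : X -> Prop) (f : X -> X) : Prop :=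
  forall x, A (f x).

Definition regular_TXA {X : Type} (A : X -> Prop) (f : X -> X) : Prop :=
  in_TXA A f /\ exists g, in_TXA A g /\ forall x, f (g (f x)) = f x.

Inductive generated {X : Type} (G : (X -> X) -> Prop) : (X -> X) -> Prop :=
  | gen_base : forall f, G f -> generated G f
  | gen_comp : forall f g, generated G f -> generated G g ->
               generated G (fun x => f (g x)).

Definition generates_Reg {X : Type} (A : X -> Prop) (G : (X -> X) -> Prop) : Prop :=
  (forall f, G f -> regular_TXA A f) /\
  (forall f, regular_TXA A f -> generated G f).

Definition has_card {U : Type} (S : U -> Prop) (n : nat) : Prop :=
  exists l : list U, NoDup l /\ length l = n /\ forall u, S u <-> In u l.

Definition finite_type (X : Type) : Prop := exists n, has_card (fun _ : X => True) n.

Definition rank_Reg_eq_nat {X : Type} (A : X -> Prop) (k : nat) : Prop :=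
  (exists G, generates_Reg A G /\ has_card G k) /\
  (forall G m, generates_Reg A G -> has_card G m -> k <= m).

Definition rank_Reg_eq_pow2 {X : Type} (A : X -> Prop) : Prop :=
  (exists G, generates_Reg A G /\
     exists (h : (X -> bool) -> {f : X -> X | G f}),
       (forall u v, h u = h v -> u = v) /\ (forall y, exists u, h u = y)) /\
  (forall G, generates_Reg A G ->
     exists (h : (X -> bool) -> {f : X -> X | G f}),
       forall u v, h u = h v -> u = v).

(* Main.v *)
(** An element of [T_X(A)] is regular iff its image equals the image of [A].

    If [X] is infinite, the idempotents fixing two given points [a, b] of [A]
    and sending every other point to itself, [a] or [b] already give [2^|X|]
    regular elements; a generating set [G] has at most [|seq G|] products, and
    [|seq G| = |G|] for infinite [G], because [|T * T| = |T|].

    If [X] is finite with [|A| = n], a regular element is determined by its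
    restriction [s : A -> A] and a map [theta : X \ A -> A] with
    [f x = s (theta x)] off [A].  Under [(s, theta) * (t, eta) = (s t, eta)], a
    factorisation of an element with [s] bijective has only such factors, and
    the rightmost one has the same [theta]: this forces one generator for each
    of the [n^k] maps [theta], plus one with [s] not bijective.  Conversely
    these suffice if the chosen permutations generate the symmetric group,
    which can be arranged except when [k = 0] and [n >= 3], where two
    permutations are needed. *)

Require Import Defs.
From Stdlib Require Import List Arith.
From mathcomp Require all_boot all_algebra all_fingroup all_classical.

(** * Cardinal arithmetic through injections *)

Module Infinite.
Import all_boot all_classical.
Local Open Scope classical_set_scope.
Local Open Scope card_scope.
Set Implicit Arguments. Unset Strict Implicit. Unset Printing Implicit Defensive.

Definition embeds (T U : Type) : Prop := exists f : T -> U, injective f.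

Lemma sval_inj (T : Type) (P : T -> Prop) : injective (@sval T P).
Proof. by move=> [x p] [y q]; exact: eq_exist. Qed.

Lemma embeds_trans (T U V : Type) : embeds T U -> embeds U V -> embeds T V.
Proof. by move=> [f fI] [g gI]; exists (g \o f); exact: inj_comp. Qed.

(** Zorn's lemma gives a maximal graph of a partial injection. If it missed a point on each side,
    that pair could be added; so it is total on one side. *)
Lemma embeds_total (T U : Type) : embeds T U \/ embeds U T.
Proof.
pose P (F : set (T * U)) :=
  (forall x y y', F (x, y) -> F (x, y') -> y = y') /\
  (forall x x' y, F (x, y) -> F (x', y) -> x = x').
have [C CP Ctot|F [[Ffun Finj] Fmax]] := @Zorn_bigcup _ P.
  have both p q : (\bigcup_(X in C) X) p -> (\bigcup_(X in C) X) q ->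
      exists2 X, C X & X p /\ X q.
    move=> [X CX Xp] [Y CY Yq].
    by have [XY|YX] := Ctot _ _ CX CY; [exists Y|exists X] => //; split; auto.
  by split=> x y z Fp Fq; have [X /CP[Xfun Xinj] [Xp Xq]] := both _ _ Fp Fq;
    [exact: Xfun Xp Xq|exact: Xinj Xp Xq].
have [dom|/existsNP[x0 /forallNP Fx0]] := pselect (forall x, exists y, F (x, y)).
  have [f Ff] := boolp.choice dom; left; exists f => x y fxy.
  by apply: Finj (Ff x) _; rewrite fxy.
have [cod|/existsNP[y0 /forallNP Fy0]] := pselect (forall y, exists x, F (x, y)).
  have [f Ff] := boolp.choice cod; right; exists f => x y fxy.
  by apply: Ffun (Ff x) _; rewrite fxy.
have [] := Fmax (F `|` [set (x0, y0)]).
  split; first by move=> p Fp; left.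
  by move=> /(_ (x0, y0) (or_intror erefl)) /Fx0.
split=> [x y y'|x x' y] [Fp|[? ?]] [Fq|[? ?]]; subst=> //.
- exact: Ffun Fp Fq.
- by have := Fx0 _ Fp.
- by have := Fx0 _ Fq.
- exact: Finj Fp Fq.
- by have := Fy0 _ Fp.
- by have := Fy0 _ Fq.
Qed.

Section Square.
Variable T : Type.
Implicit Types F : set (T * T * T).

(* A partial pairing function is coded by its graph; its carrier is read off
   the diagonal. *)
Definition carrier F (x : T) : Prop := exists z, F (x, x, z).

Definition pairing F : Prop :=
  [/\ forall x y z z', F (x, y, z) -> F (x, y, z') -> z = z',
      forall x y x' y' z, F (x, y, z) -> F (x', y', z) -> x = x' /\ y = y',
      forall x y z, F (x, y, z) -> [/\ carrier F x, carrier F y & carrier F z] &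
      forall x y, carrier F x -> carrier F y -> exists z, F (x, y, z)].

(** Zorn's lemma is applied to the graphs [F] whose union with [F0] is a pairing. This makes the
    empty chain harmless and puts [F0] inside the maximal pairing. *)
Lemma maximal_pairing F0 : pairing F0 ->
  exists F, [/\ pairing F, F0 `<=` F &
                forall H, pairing H -> F `<=` H -> H `<=` F].
Proof.
move=> F0p.
have [C CP Ctot|F [Fp Fmax]] := @Zorn_bigcup _ (fun F => pairing (F `|` F0)).
  set U := \bigcup_(X in C) X.
  have both p q : (U `|` F0) p -> (U `|` F0) q -> exists X,
      [/\ pairing X, X `<=` U `|` F0, X p & X q].
    move=> [[X CX Xp]|Fp] [[Y CY Yq]|Fq].
    + have [XY|YX] := Ctot _ _ CX CY.
        exists (Y `|` F0); split; [exact: CP| |by left; exact: XY|by left].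
        by apply: setSU => z Yz; exists Y.
      exists (X `|` F0); split; [exact: CP| |by left|by left; exact: YX].
      by apply: setSU => z Xz; exists X.
    + exists (X `|` F0); split; [exact: CP| |by left|by right].
      by apply: setSU => z Xz; exists X.
    + exists (Y `|` F0); split; [exact: CP| |by right|by left].
      by apply: setSU => z Yz; exists Y.
    + by exists F0; split=> // z; right.
  split.
  - move=> x y z z' p q; have [X [[Xf _ _ _] _ Xp Xq]] := both _ _ p q.
    exact: Xf Xp Xq.
  - move=> x y x' y' z p q; have [X [[_ Xi _ _] _ Xp Xq]] := both _ _ p q.
    exact: Xi Xp Xq.
  - move=> x y z p; have [X [[_ _ Xc _] XU Xp _]] := both _ _ p p.
    by have [[u ?] [v ?] [w ?]] := Xc _ _ _ Xp; split;
      [exists u|exists v|exists w]; exact: XU.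
  - move=> x y [u p] [v q]; have [X [[_ _ _ Xt] XU Xp Xq]] := both _ _ p q.
    have [| |z Xz] := Xt x y; [by exists u|by exists v|].
    by exists z; exact: XU.
exists (F `|` F0); split=> [//||H Hp FH]; first by move=> z; right.
apply: contrapT => HF; apply: (Fmax H); last first.
  by have -> : H `|` F0 = H by apply/setUidPl => z ?; apply: FH; right.
split; first by move=> z ?; apply: FH; left.
by move=> HF'; apply: HF => z /HF' ?; left.
Qed.

(** Let [D] be the carrier of a maximal pairing. If the complement of [D] embeds in [D], two tags
    embed [T] in [D], and [T * T] follows. Otherwise [D] embeds in its complement, which leaves room
    to extend the pairing. *)
Lemma embeds_square : embeds nat T -> embeds (T * T) T.
Proof.
move=> [e eI].
(* Starting from the countable pairing on the range of [e] ensures that every [e i] lies in the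
   carrier and can be used as a tag. *)
pose B : set (T * T * T) :=
  fun p => exists i j : nat, p = (e i, e j, e (pickle (i, j))).
have carB x : carrier B x <-> exists i, x = e i.
  split=> [[z [i [j [-> _ _]]]]|[i ->]]; first by exists i.
  by exists (e (pickle (i, i))); exists i, i.
have /maximal_pairing[F [[Ff Fi Fc Ft] BF Fmax]] : pairing B.
  split.
  - by move=> ? ? ? ? [i [j [-> -> ->]]] [i' [j' [/eI-> /eI-> ->]]].
  - move=> ? ? ? ? ? [i [j [-> -> ->]]] [i' [j' [-> -> /eI]]].
    by move=> /(pcan_inj pickleK)[-> ->].
  - by move=> ? ? ? [i [j [-> -> ->]]]; split; apply/carB; eexists.
  - move=> x y /carB[i ->] /carB[j ->].
    by exists (e (pickle (i, j))); exists i, j.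
pose D := carrier F.
have De i : D (e i) by exists (e (pickle (i, i))); apply: BF; exists i, i.
have /boolp.choice[p Fp] : forall xy : T * T, exists z,
    D xy.1 -> D xy.2 -> F (xy.1, xy.2, z).
  move=> [x y]; have [Dx|?] := pselect (D x); last by exists x.
  have [Dy|?] := pselect (D y); last by exists x.
  by have [z ?] := Ft _ _ Dx Dy; exists z.
have Dp x y : D x -> D y -> D (p (x, y)).
  by move=> Dx Dy; have [] := Fc _ _ _ (Fp (x, y) Dx Dy).
have pI x y x' y' : D x -> D y -> D x' -> D y' ->
    p (x, y) = p (x', y') -> x = x' /\ y = y'.
  move=> Dx Dy Dx' Dy' E; apply: Fi (Fp (x, y) Dx Dy) _.
  by rewrite E; exact: (Fp (x', y')).
have [[f fI]|[f fI]] := embeds_total {x | ~ D x} {x | D x}.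
  have [g gD gI] : exists2 g : T -> T, (forall x, D (g x)) & injective g.
    exists (fun x => match pselect (D x) with
      | left _ => p (x, e 0) | right Nx => p (sval (f (exist _ x Nx)), e 1) end).
      move=> x; case: pselect => [Dx|Nx]; first exact: Dp.
      by apply: Dp => //; exact: svalP.
    move=> x y; case: pselect => [Dx|Nx]; case: pselect => [Dy|Ny].
    - by move=> /pI[].
    - by move=> /pI[//|//||//|_ /eI//]; exact: svalP.
    - by move=> /pI[|//|//|//|_ /eI//]; exact: svalP.
    - move=> /pI[|//||//|]; try exact: svalP.
      by move=> /sval_inj/fI/(congr1 sval).
  exists (fun xy => p (g xy.1, g xy.2)).
  by move=> -[x y] [x' y'] /= /pI[//|//|//|//|/gI-> /gI->].
have [g gD gI] : exists2 g : T -> T, (forall x, D x -> ~ D (g x)) &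
    (forall x y, D x -> D y -> g x = g y -> x = y).
  exists (fun x => match pselect (D x) with
    | left Dx => sval (f (exist _ x Dx)) | right _ => x end).
    by move=> x Dx; case: pselect => // ?; exact (svalP (f _)).
  move=> x y Dx Dy; case: pselect => // ?; case: pselect => // ?.
  by move=> /sval_inj/fI/(congr1 sval).
(* A copy [g D] of the carrier disjoint from it can absorb the three new
   blocks of the square of [D `|` g D], so [F] was not maximal. *)
pose q (s : bool) x := if s then g x else x.
(* The tags 1, 2, 3 given by [s + t.*2] separate the three new blocks; without a tag, [w] is [p], so
   that the new pairing extends [F]. *)
pose w (s t : bool) a b :=
  if s || t then p (e (s + t.*2), p (a, b)) else p (a, b).
have Dw s t a b : D a -> D b -> D (w s t a b).
  by move=> Da Db; rewrite /w; case: ifP => _; [apply: (Dp _ _ (De _))|]; exact: Dp.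
have qI s t a b : D a -> D b -> q s a = q t b -> s = t /\ a = b.
  move=> Da Db; case: s t => -[] //=; [by move/gI=> ->| |].
  - by move=> E; case: (gD a Da); rewrite E.
  - by move=> E; case: (gD b Db); rewrite -E.
have wI s t s' t' a b a' b' : D a -> D b -> D a' -> D b' -> s || t = s' || t' ->
    w s t a b = w s' t' a' b' -> [/\ s = s', t = t', a = a' & b = b'].
  move=> Da Db Da' Db' E; rewrite /w -E; case: ifP => st.
    move=> /pI[//||//||/eI st']; try exact: Dp.
    by move=> /pI[//|//|//|//|-> ->]; split=> //; move: st';
      case: (s) (t) (s') (t') => -[] [] [].
  move=> /pI[//|//|//|//|-> ->]; split=> //; move: E st;
    by case: (s) (t) (s') (t') => -[] [] [].
pose H : set (T * T * T) := fun r => exists s t a b,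
  [/\ D a, D b & r = (q s a, q t b, q (s || t) (w s t a b))].
have carH x : carrier H x <-> exists s a, D a /\ x = q s a.
  split=> [[z [s [t [a [b [Da Db [-> _ _]]]]]]]|[s [a [Da ->]]]].
    by exists s, a.
  by exists (q (s || s) (w s s a a)), s, s, a, a.
have c1 : carrier H (g (e 0)) by apply/carH; exists true, (e 0).
(* Maximality would put this triple of [H] in [F], hence [g (e 0)] in [D], although [g] maps [D]
   outside [D]. *)
suff [z0 /Fmax Hz0] : exists z, H (g (e 0), g (e 0), z); last first.
  by have [z] := c1; exists z.
case: (gD (e 0) (De 0)); exists z0; apply: Hz0; last first.
  move=> [[x y] z] Fxyz; have [Dx Dy Dz] := Fc _ _ _ Fxyz.
  exists false, false, x, y; split=> //=; congr (_, _, _).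
  exact: Ff Fxyz (Fp (x, y) Dx Dy).
split.
- move=> x y z z' [s [t [a [b [Da Db [-> -> ->]]]]]].
  move=> [s' [t' [a' [b' [Da' Db' [Ex Ey ->]]]]]].
  have [-> ->] := qI _ _ _ _ Da Da' Ex.
  by have [-> ->] := qI _ _ _ _ Db Db' Ey.
- move=> x y x' y' z [s [t [a [b [Da Db [-> -> ->]]]]]].
  move=> [s' [t' [a' [b' [Da' Db' [-> -> Ez]]]]]].
  have [Est Ew] := qI _ _ _ _ (Dw s t _ _ Da Db) (Dw s' t' _ _ Da' Db') Ez.
  by have [-> -> -> ->] := wI _ _ _ _ _ _ _ _ Da Db Da' Db' Est Ew.
- move=> x y z [s [t [a [b [Da Db [-> -> ->]]]]]]; split; apply/carH.
  + by exists s, a.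
  + by exists t, b.
  + by exists (s || t), (w s t a b); split; [exact: Dw|].
- move=> x y /carH[s [a [Da ->]]] /carH[t [b [Db ->]]].
  by exists (q (s || t) (w s t a b)), s, t, a, b.
Qed.
End Square.

(** Nested pairs can be decoded only if their depth is known, since the end mark [e 0] may itself be
    a pair; the length is therefore stored too. *)
Lemma embeds_seq (T : Type) : embeds nat T -> embeds (seq T) T.
Proof.
move=> TN; have [p pI] := embeds_square TN; have [e eI] := TN.
pose code := foldr (fun x y => p (x, y)) (e 0).
exists (fun l => p (e (size l), code l)) => l l' /pI[/eI].
elim: l l' => [|x l IHl] [|x' l'] //= [/IHl E] /pI[-> /E ->] //.
Qed.

Lemma cantor (T : Type) : ~ embeds (T -> bool) T.
Proof.
move=> [f fI]; pose u x := `[< exists v, f v = x /\ v x = false >].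
have uf : u (f u) -> u (f u) = false by move=> /asboolP[v [/fI->]].
have fu : u (f u) = false -> u (f u) by move=> E; apply/asboolP; exists u.
by have [/[dup] /uf ->|/negbTE/[dup] /fu ->] := boolP (u (f u)).
Qed.

(** If [U] is infinite, words over [U] embed in [U]. Otherwise [U] embeds in [nat], its words are
    countable, and [X -> bool] would embed in [X], against Cantor. *)
Lemma pow_embeds_seq (X U : Type) :
  embeds nat X -> embeds (X -> bool) (seq U) -> embeds (X -> bool) U.
Proof.
move=> NX XU; have [NU|[f fI]] := embeds_total nat U.
  exact: embeds_trans XU (embeds_seq NU).
case: (@cantor X); apply: embeds_trans XU _; apply: embeds_trans NX.
by exists (fun l => pickle (map f l)) => l l' /(pcan_inj pickleK)/(inj_map fI).
Qed.

Lemma Cantor_Bernstein_embeds (T U : Type) : embeds T U -> embeds U T ->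
  exists h : T -> U, (forall x y, h x = h y -> x = y) /\ forall y, exists x, h x = y.
Proof.
elim/Ppointed: U => U; first by move=> [f fI] _; exists f; split=> // y; case: (no y).
elim/Ppointed: T => T; first by move=> _ [g gI]; case: (no (g point)).
move=> [f fI] [g gI].
have /card_set_bijP[h [_ hI hS]] : [set: T] #= [set: U].
  by apply: Cantor_Bernstein; apply/pcard_injP; [exists f|exists g] => x y _ _;
    [exact: fI|exact: gI].
exists h; split=> [x y|y]; first by apply: hI; rewrite inE.
by have [x _ <-] := hS y I; exists x.
Qed.

Lemma infinite_embeds_nat (X : Type) : ~ finite_type X -> embeds nat X.
Proof.
move=> Xinf.
have /boolp.choice[g gP] : forall l : list X, exists x, ~ List.In x l.
  move=> l; apply/existsNP => lX; apply: Xinf.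
  exists (length (List.nodup (fun x y => pselect (x = y)) l)).
  exists (List.nodup (fun x y => pselect (x = y)) l).
  split; first exact: List.NoDup_nodup.
  by split=> // u; split=> // _; apply/List.nodup_In.
(* [s n] lists the first [n] chosen points, and [g] picks a point outside a list. *)
pose s := fix s n := if n is m.+1 then g (s m) :: s m else [::].
have lt_s m n : m < n -> List.In (g (s m)) (s n).
  elim: n => //= n IHn; rewrite ltnS leq_eqVlt => /orP[/eqP->|/IHn]; [by left|by right].
exists (g \o s) => m n /= E; case: (ltngtP m n) => // /lt_s.
  by rewrite E => /gP.
by rewrite -E => /gP.
Qed.

(** * The rank over an infinite set *)

Section InfiniteRank.
Variables (X : Type) (A : X -> Prop).

Lemma generated_prod (G : (X -> X) -> Prop) f : generated G f ->
  exists l : seq {g | G g}, f = foldr (fun g h => sval g \o h) id l.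
Proof.
elim=> [g Gg|g h _ [l ->] _ [l' ->]]; first by exists [:: exist _ g Gg].
exists (l ++ l'); rewrite foldr_cat.
by elim: l => //= g' l IHl; rewrite -IHl.
Qed.

Hypothesis NX : embeds nat X.

(** The maps [p (_, e n)] are injective with disjoint ranges, so among three of them one avoids both
    points. *)
Lemma embeds_avoiding (a b : X) :
  exists2 j : X -> X, injective j & forall x, j x <> a /\ j x <> b.
Proof.
have [p pI] := embeds_square NX; have [e eI] := NX.
apply: contrapT => noj.
have bad n : exists x, p (x, e n) = a \/ p (x, e n) = b.
  apply: contrapT => /forallNP ok; apply: noj.
  exists (fun x => p (x, e n)); first by move=> x y /pI[].
  by move=> x; have /not_orP := ok x.
have [[x Ex] [y Ey]] := (bad 0, bad 1); have [z Ez] := bad 2.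
have ne u v m n c : m != n -> p (u, e m) = c -> p (v, e n) = c -> False.
  by move=> /eqP mn <- /pI[_ /eI] /esym.
by case: Ex Ey Ez => [Ex|Ex] [Ey|Ey] [Ez|Ez];
  first [exact: (ne x y 0 1 _ isT Ex Ey)|exact: (ne x z 0 2 _ isT Ex Ez)
        |exact: (ne y z 1 2 _ isT Ey Ez)].
Qed.

(** The subset [u] is moved along [j], away from [a] and [b], so that [u y] can be read off from
    whether [F u] sends [j y] to [a]. *)
Lemma embeds_pow_regular (a b : X) : A a -> A b -> a <> b ->
  embeds (X -> bool) {f | regular_TXA A f}.
Proof.
move=> Aa Ab ab; have [j jI jab] := embeds_avoiding a b.
pose F (u : X -> bool) x :=
  if pselect (x = a) then a else if pselect (x = b) then b else
  if pselect (exists2 y, j y = x & u y) then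
    if pselect (A x) then x else b else a.
have FA u : in_TXA A (F u) by move=> x; rewrite /F; do !case: pselect => //.
have FF u x : F u (F u x) = F u x.
  by rewrite {2 3}/F; do !case: pselect => //= *; rewrite /F;
    do !case: pselect => //.
have Freg u : regular_TXA A (F u).
  by split=> //; exists (F u); split=> // x; rewrite !FF.
exists (fun u => exist _ (F u) (Freg u)) => u v /(congr1 sval)/= E.
have Fj (w : X -> bool) y : w y <-> F w (j y) <> a.
  have [ja jb] := jab y; rewrite /F.
  case: (pselect (j y = a)) => [//|ya /=].
  case: (pselect (j y = b)) => [//|yb /=].
  case: pselect => [yz|nyz] /=; last by split=> // wy; case: nyz; exists y.
  split=> _; first by case: pselect => //= _ /esym.
  by case: yz => z /jI <-.
by apply/funext => y; apply/idP/idP => /Fj; [rewrite E|rewrite -E] => /Fj.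
Qed.

(** A pairing of [X] turns the graph of a map into a subset of [X]. *)
Lemma embeds_regular_pow : embeds {f | regular_TXA A f} (X -> bool).
Proof.
have [p pI] := embeds_square NX.
exists (fun f z => `[< exists x, p (x, sval f x) = z >]) => f g E.
apply: sval_inj; apply/funext => x.
have : `[< exists y, p (y, sval g y) = p (x, sval f x) >].
  by have := congr1 (@^~ (p (x, sval f x))) E => /= <-; apply/asboolP; exists x.
by move=> /asboolP[y /pI[-> ->]].
Qed.

Lemma embeds_pow_generators (G : (X -> X) -> Prop) (a b : X) :
  A a -> A b -> a <> b -> generates_Reg A G -> embeds (X -> bool) {f | G f}.
Proof.
move=> Aa Ab ab [_ Ggen]; apply: pow_embeds_seq NX _.
apply: embeds_trans (embeds_pow_regular Aa Ab ab) _.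
have /boolp.choice[l lP] : forall f : {f | regular_TXA A f}, exists l : seq {g | G g},
    sval f = foldr (fun g h => sval g \o h) id l.
  by move=> [f fr]; exact: generated_prod (Ggen f fr).
by exists l => f g E; apply: sval_inj; rewrite !lP E.
Qed.

End InfiniteRank.

Lemma rank_infinite (X : Type) (A : X -> Prop) :
  (exists a b, A a /\ A b /\ a <> b) -> ~ finite_type X -> rank_Reg_eq_pow2 A.
Proof.
move=> [a [b [Aa [Ab ab]]]] /infinite_embeds_nat NX; split.
  exists (regular_TXA A); split; first by split=> // f; exact: gen_base.
  apply: Cantor_Bernstein_embeds; last exact: embeds_regular_pow.
  exact (embeds_pow_regular NX Aa Ab ab).
move=> G Ggen; have [h hI] := embeds_pow_generators NX Aa Ab ab Ggen.
by exists h => u v; exact: hI.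
Qed.

End Infinite.

Module Finite.
Import all_boot all_algebra all_fingroup boolp.
Set Implicit Arguments. Unset Strict Implicit. Unset Printing Implicit Defensive.

(** * Generators of the full transformation semigroup on a finite set of at least two points *)

Section Transformations.
Variable n : nat.
Local Notation I := 'I_n.+2.

Definition cycle_perm : {perm I} := perm (@GRing.addrI _ (1%R : I)).
Definition swap_perm : {perm I} := tperm 0%R 1%R.
Definition collapse (x : I) : I := if x == 0%R then 1%R else x.

Lemma collapse_not_injective : ~ injective collapse.
Proof. by move=> /(_ 0%R 1%R erefl). Qed.

(* Increasing the rank: if [f i = f j] and [c] is not a value of [f], then
   [f = e \o f'], where [f'] sends [i] to [c] and agrees with [f] elsewhere, and
   [e] sends [c] to [f j]. *)
Lemma transformations_generated (H : (I -> I) -> Prop) :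
  (forall f g, H f -> H g -> H (f \o g)) ->
  H cycle_perm -> H swap_perm -> H collapse -> forall f, H f.
Proof.
move=> Hcomp Hc Ht He.
have Hperm (s : {perm I}) : H s.
  pose K := [set s : {perm I} | `[<H s>]].
  have KP (p : {perm I}) : reflect (H p) (p \in K) by rewrite in_set; exact: asboolP.
  have KG : group_set K.
    apply/group_setP; split=> [|p q /KP Hp /KP Hq]; apply/KP.
      (* [H] is not assumed of the identity, which is obtained as the square of the
         transposition. *)
      rewrite -(tperm2 0%R 1%R).
      have -> : (swap_perm * swap_perm)%g = swap_perm \o swap_perm :> (I -> I).
        by apply/funext => x; rewrite permM.
      exact (Hcomp _ _ Ht Ht).
    have -> : (p * q)%g = q \o p :> (I -> I) by apply/funext => x; rewrite permM.
    exact (Hcomp _ _ Hq Hp).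
  have : s \in [set: {perm I}] by rewrite in_setT.
  have <- := @gen_tpermn_circular_shift n 0%R 1%R; last first.
    by rewrite GRing.subr0 coprimen1.
  suff /subsetP sub : (<<[set tperm 0%R 1%R; cycle_perm]>> \subset Group KG)%g.
    by move=> /sub/KP.
  by rewrite gen_subG; apply/subsetP => p; rewrite in_set2 => /orP[]/eqP->; apply/KP.
have Hcollapse i j : i != j -> H (fun x => if x == i then j else x).
  (* [p] sends 0 to [i] and 1 to [j], so conjugating [collapse] by it moves [i] to [j] and fixes the
     rest. *)
  move=> ij; pose p := (tperm 0%R i * tperm (tperm 0%R i 1%R) j)%g : {perm I}.
  have p0 : p 0%R = i.
    have : tperm 0%R i 1%R != tperm 0%R i 0%R by rewrite (inj_eq perm_inj).
    by rewrite permM tpermL => ti; apply: tpermD => //; rewrite eq_sym.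
  have p1 : p 1%R = j by rewrite permM tpermL.
  have -> : (fun x => if x == i then j else x) = p \o (collapse \o (p^-1)%g).
    apply/funext => x /=; rewrite /collapse (can2_eq (permKV p) (permK p)) p0.
    by case: ifP => _; rewrite ?p1 ?permKV.
  exact (Hcomp _ _ (Hperm p) (Hcomp _ _ He (Hperm p^-1%g))).
move=> f; have [r] := ubnP (n.+2 - #|codom f|); elim: r f => // r IHr f fr.
have [/injectiveP fI|/injectivePn[i [j ij fij]]] := boolP (injectiveb f).
  have -> : f = perm fI by apply/funext => x; rewrite permE.
  exact: Hperm.
have [c cf] : exists c, c \notin codom f.
  apply/existsP; apply: contraTT ij => /existsPn cov; rewrite negbK.
  have /eqP/image_injP fI : #|codom f| = #|I|.
    by apply: eq_card => x; have := cov x; rewrite negbK => ->.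
  by apply/eqP; apply: fI.
pose f' x := if x == i then c else f x.
have -> : f = (fun x => if x == c then f j else x) \o f'.
  apply/funext => x; rewrite /f' /=; have [->|_] := eqVneq x i; first by rewrite eqxx.
  by case: eqP => // fx; move: cf; rewrite -fx codom_f.
apply: Hcomp; first by apply: Hcollapse; apply: contraNneq cf => ->; exact: codom_f.
apply: IHr; apply: leq_trans _ (fr : _ <= r).
have cn g : #|codom (g : I -> I)| <= n.+2.
  by apply: leq_trans (max_card _) _; rewrite card_ord.
suff lt_ff' : #|codom f| < #|codom f'|.
  by apply: ltn_sub2l => //; apply: leq_trans lt_ff' _.
apply: proper_card; apply/properP; split.
  apply/subsetP => y /codomP[x ->]; apply/codomP; rewrite /f'.
  have [->|xi] := eqVneq x i; last by exists x; rewrite (negbTE xi).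
  by exists j; rewrite eq_sym (negbTE ij).
by exists c => //; apply/codomP; exists i; rewrite /f' eqxx.
Qed.

End Transformations.

(** * Counting with duplicate-free lists *)

Lemma InP (T : eqType) (x : T) (s : seq T) : reflect (In x s) (x \in s).
Proof.
elim: s => [|y s IHs] /=; first by rewrite in_nil; constructor.
by rewrite inE; apply: (iffP orP) => [[/eqP->|/IHs]|[->|/IHs]]; rewrite ?eqxx; auto.
Qed.

Lemma NoDup_map_uniq (T : eqType) (U : Type) (f : T -> U) (s : seq T) :
  injective f -> uniq s -> NoDup [seq f x | x <- s].
Proof.
move=> fI; elim: s => [|x s IHs] /=; first by constructor.
move=> /andP[xs /IHs ?]; constructor => // /in_map_iff[y [/fI-> ys]].
by move/negP: xs; apply; exact/InP.
Qed.

Lemma has_card_ge (U : Type) (S : U -> Prop) m (s : seq U) :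
  has_card S m -> NoDup s -> (forall u, In u s -> S u) -> le (size s) m.
Proof.
move=> [l [_ [<- Sl]]] s_nd sS.
by apply: (NoDup_incl_length s_nd) => u /sS/Sl.
Qed.

Lemma has_card_enum (U : Type) (S : U -> Prop) n : has_card S n ->
  exists e : 'I_n -> U, injective e /\ forall u, S u <-> exists i, e i = u.
Proof.
move=> [l [l_nd [<- lS]]]; case: l l_nd lS => [|x0 l'] l_nd lS.
  by exists (fun i : 'I_0 => match notF (ltn_ord i) with end); split;
    [case|move=> u; split=> [/lS //|[[]]]].
set l := x0 :: l' in l_nd lS *; exists (fun i => List.nth i l x0); split.
  move=> i j /(proj1 (NoDup_nth l x0) l_nd i j (ltP (ltn_ord i)) (ltP (ltn_ord j))).
  exact: val_inj.
move=> u; split=> [/lS/(In_nth l u x0)[i [/ltP il <-]]|[i <-]].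
  by exists (Ordinal il).
by apply/lS/nth_In/ltP.
Qed.

(** * Regular elements in coordinates *)

Section Coding.
Variables (X : Type) (A : X -> Prop) (n k : nat).
Local Notation I := 'I_n.+2.
Local Notation J := 'I_k.
Variables (d : I + J -> X) (c : X -> I + J).
Hypotheses (dK : cancel d c) (cK : cancel c d).
Hypotheses (dA : forall i, A (d (inl i))) (dNA : forall j, ~ A (d (inr j))).

(** [d] identifies [I] with [A] and [J] with its complement, so [s] and [phi] are the restrictions
    to these two sets. *)
Definition tmap (s : I -> I) (phi : J -> I) (x : X) : X :=
  d (inl (match c x with inl i => s i | inr j => phi j end)).

(* For injective [s], the kernel of [rmap s theta] identifies each [j] with
   [theta j], and nothing else. *)
Definition rmap (s : I -> I) (theta : J -> I) : X -> X := tmap s (s \o theta).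

Lemma tmap_inj s phi t psi : tmap s phi = tmap t psi -> s = t /\ phi = psi.
Proof.
move=> E; split; apply/funext => i.
  by have := congr1 (@^~ (d (inl i))) E; rewrite /tmap dK => /(can_inj dK)[].
by have := congr1 (@^~ (d (inr i))) E; rewrite /tmap dK => /(can_inj dK)[].
Qed.

Lemma tmapP f : in_TXA A f -> exists s phi, f = tmap s phi.
Proof.
move=> fA.
have f' x : exists i, f x = d (inl i).
  case E : (c (f x)) => [i|j]; first by exists i; rewrite -E cK.
  by have := fA x; rewrite -[f x]cK E => /dNA.
have /choice[g gE] := f'.
exists (fun i => g (d (inl i))), (fun j => g (d (inr j))).
by apply/funext => x; rewrite gE /tmap; case E : (c x) => [i|j]; rewrite -E cK.
Qed.

Lemma tmap_comp s phi t psi :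
  tmap s phi \o tmap t psi = tmap (s \o t) (s \o psi).
Proof. by apply/funext => x; rewrite /tmap /= dK; case: (c x). Qed.

Lemma rmap_comp s theta t eta :
  rmap s theta \o rmap t eta = rmap (s \o t) eta.
Proof. by rewrite /rmap tmap_comp. Qed.

Lemma rmap_inj s theta t eta : rmap s theta = rmap t eta ->
  s = t /\ (injective s -> theta = eta).
Proof.
move=> /tmap_inj[<- E]; split=> // sI; apply/funext => j; apply: sI.
exact: (congr1 (@^~ j) E).
Qed.

(** Off [A], the equation [f g f = f] reads [s (t (phi j)) = phi j], so [phi] factors through [s]
    with [theta = t \o phi]. Conversely, a [t] choosing preimages under [s] gives an inverse,
    because [s \o t \o s = s] and a product keeps the [theta] of its rightmost factor. *)
Lemma regularP f : regular_TXA A f <-> exists s theta, f = rmap s theta.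
Proof.
split=> [[/tmapP[s [phi ->]] [g [/tmapP[t [psi ->]] fgf]]]|[s [theta ->]]].
  have : tmap s phi \o (tmap t psi \o tmap s phi) = tmap s phi.
    by apply/funext.
  by rewrite !tmap_comp => /tmap_inj[_ E]; exists s, (t \o phi); rewrite /rmap E.
split=> [x|]; first exact: dA.
have /choice[t tP] : forall y, exists x, (exists x', s x' = y) -> s x = y.
  by move=> y; have [[x sx]|?] := pselect (exists x, s x = y); [exists x|exists ord0].
exists (rmap t (fun=> ord0)); split=> [x|x]; first exact: dA.
suff /(congr1 (@^~ x)) : rmap s theta \o (rmap t (fun=> ord0) \o rmap s theta)
    = rmap s theta by [].
rewrite !rmap_comp; congr rmap; apply/funext => i /=.
by apply: tP; exists i.
Qed.

(** [rmap s theta] splits with right factor [rmap p theta] from [G], where [p] is a permutation. The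
    left factor must only act on [A] as [s \o p^-1], whatever its own [eta], and the first three
    generators provide such an element. *)
Lemma generates_RegP (G : (X -> X) -> Prop) :
  (forall f, G f -> regular_TXA A f) ->
  (exists theta, G (rmap (cycle_perm n) theta)) ->
  (exists theta, G (rmap (swap_perm n) theta)) ->
  (exists theta, G (rmap (@collapse n) theta)) ->
  (forall theta, exists s : {perm I}, G (rmap s theta)) ->
  generates_Reg A G.
Proof.
move=> Greg [theta_c Gc] [theta_t Gt] [theta_e Ge] Gker; split=> //.
have allI s : exists theta, Defs.generated G (rmap s theta).
  apply: (@transformations_generated n (fun s => exists theta,
    Defs.generated G (rmap s theta))).
  - move=> f g [theta Gf] [eta Gg]; exists eta; rewrite -(rmap_comp f theta).
    exact: gen_comp.
  - by exists theta_c; exact: gen_base.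
  - by exists theta_t; exact: gen_base.
  - by exists theta_e; exact: gen_base.
move=> f /regularP[s [theta ->]]; have [p Gp] := Gker theta.
have [eta Gs] := allI (s \o (p^-1)%g).
have -> : rmap s theta = rmap (s \o (p^-1)%g) eta \o rmap p theta.
  by rewrite rmap_comp; congr rmap; apply/funext => i /=; rewrite permK.
by apply: gen_comp => //; exact: gen_base.
Qed.

(** * Lower bounds on the number of generators *)

Section Generators.
Variable G : (X -> X) -> Prop.
Hypothesis Ggen : generates_Reg A G.

Lemma generator_rmap g : G g -> exists s theta, g = rmap s theta.
Proof. by move=> /(proj1 Ggen)/regularP. Qed.

(* The kernel of an element acting injectively on [A] is that of its
   rightmost factor. *)
Lemma generator_with_kernel theta :
  exists t, injective t /\ G (rmap t theta).
Proof.
suff gen f : Defs.generated G f -> exists s theta,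
    f = rmap s theta /\ (injective s -> exists t, injective t /\ G (rmap t theta)).
  have /(proj2 Ggen)/gen[s [eta [/rmap_inj[<- /(_ (@inj_id _))->]]]] :
      regular_TXA A (rmap id theta) by apply/regularP; exists id, theta.
  by apply; exact: inj_id.
elim=> [g Gg|{}f g _ [s [eta [-> _]]] _ [t [xi [-> IH]]]].
  by have [s [eta E]] := generator_rmap Gg;
    exists s, eta; split=> // sI; exists s; rewrite -E.
exists (s \o t), xi; split; first by rewrite -(rmap_comp s eta).
by move=> /inj_compr; exact: IH.
Qed.

(** Products of elements injective on [A] are injective on [A], but a constant map is regular and is
    not. *)
Lemma generator_not_injective :
  exists t theta, ~ injective t /\ G (rmap t theta).
Proof.
apply: contrapT => noG.
have gen f : Defs.generated G f -> exists s theta, injective s /\ f = rmap s theta.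
  elim=> [g Gg|{}f g _ [s [eta [sI ->]]] _ [t [xi [tI ->]]]].
    have [s [eta E]] := generator_rmap Gg; exists s, eta; split=> //.
    by apply: contrapT => sNI; apply: noG; exists s, eta; rewrite -E.
  exists (s \o t), xi; split; first exact: inj_comp.
  by rewrite -(rmap_comp s eta).
have /(proj2 Ggen)/gen[s [theta [sI /rmap_inj[/esym sE _]]]] :
    regular_TXA A (rmap (fun=> ord0) (fun=> ord0)).
  by apply/regularP; exists (fun=> ord0), (fun=> ord0).
by have := sI ord0 ord_max; rewrite sE => /(_ erefl)/(congr1 val).
Qed.

(** If all generators injective on [A] acted there as one [s], every permutation of [I] would be a
    power of [s]; but the transpositions (0 1) and (1 2) do not commute. *)
Lemma two_injective_generators : 0 < n ->
  exists s t theta eta, [/\ injective s, injective t, s <> t,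
    G (rmap s theta) & G (rmap t eta)].
Proof.
move=> n0; apply: contrapT => noG.
have [s [sI Gs]] := generator_with_kernel (fun=> ord0).
have gen f : Defs.generated G f -> exists t theta, f = rmap t theta /\
    (injective t -> exists m, t = iter m s).
  elim=> [g Gg|{}f g _ [u [eta [-> IHu]]] _ [t [xi [-> IHt]]]].
    have [t [eta E]] := generator_rmap Gg; exists t, eta; split=> // tI.
    exists 1; apply: contrapT => st; apply: noG.
    by exists s, t, (fun=> ord0), eta; split=> //;
      [move=> E'; apply: st; rewrite E'|rewrite -E].
  exists (u \o t), xi; split; first by rewrite -(rmap_comp u eta).
  move=> utI; have /IHt[l tE] := inj_compr utI.
  (* [t] is injective on a finite set, hence bijective, so injectivity of [u \o t] passes to [u]. *)
  have /IHu[m uE] : injective u.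
    have [t' _ t'K] := injF_bij (inj_compr utI).
    by move=> x y; rewrite -(t'K x) -(t'K y) => /utI ->.
  by exists (m + l); apply/funext => x; rewrite /= uE tE iterD.
have powers (p : {perm I}) : exists m, p =1 iter m s.
  have /(proj2 Ggen)/gen[t [theta [/rmap_inj[<- _] E]]] :
    regular_TXA A (rmap p (fun=> ord0)) by apply/regularP; exists p, (fun=> ord0).
  by have [m ->] := E (@perm_inj _ p); exists m.
pose i2 : I := Ordinal (n0 : 2 < n.+2).
have [l lE] := powers (tperm 0%R 1%R); have [m mE] := powers (tperm 1%R i2).
have : tperm 0%R 1%R (tperm 1%R i2 0%R) = tperm 1%R i2 (tperm 0%R 1%R 0%R).
  by rewrite !lE !mE -!iterD addnC.
by rewrite tpermL tpermL (tpermD (z := 0%R)) // tpermL => /(congr1 val).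
Qed.

Lemma rank_ge_kernels m : has_card G m -> le (n.+2 ^ k).+1 m.
Proof.
move=> Gm.
have /choice[t tP] : forall theta : {ffun J -> I},
    exists t, injective t /\ G (rmap t theta).
  by move=> theta; exact: generator_with_kernel.
have [t0 [theta0 [t0NI Gt0]]] := generator_not_injective.
pose g theta := rmap (t theta) (theta : {ffun J -> I}).
have gI : injective g.
  move=> theta eta /rmap_inj[_ E]; apply/ffunP => j.
  by rewrite (E (proj1 (tP theta))).
have -> : (n.+2 ^ k).+1 =
    size (rmap t0 theta0 :: [seq g theta | theta <- enum {ffun J -> I}]).
  by rewrite /= size_map -cardE card_ffun !card_ord.
apply: (has_card_ge Gm).
  constructor; last exact: NoDup_map_uniq gI (enum_uniq _).
  by move=> /in_map_iff[theta [/rmap_inj[E _] _]]; apply: t0NI; rewrite -E; case: (tP theta).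
by move=> u [<- //|/in_map_iff[theta [<- _]]]; case: (tP theta).
Qed.

Lemma rank_ge3 m : 0 < n -> has_card G m -> le 3 m.
Proof.
move=> n0 Gm; have [t0 [theta0 [t0NI Gt0]]] := generator_not_injective.
have [s [t [theta [eta [sI tI st Gs Gt]]]]] := two_injective_generators n0.
apply: (has_card_ge (s := [:: rmap t0 theta0; rmap s theta; rmap t eta]) Gm).
  constructor=> [[/rmap_inj[E _]|[/rmap_inj[E _]|//]]|]; [by apply: t0NI; rewrite -E..|].
  by constructor=> [[/rmap_inj[E _]|//]|]; [apply: st|constructor=> //; constructor].
by move=> u [<-|[<-|[<-|]]].
Qed.

End Generators.

(** * The exact rank in the finite cases *)

Lemma rank_kernels : ~ (0 < n /\ k = 0) -> rank_Reg_eq_nat A (n.+2 ^ k).+1.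
Proof.
move=> nk; split; last by move=> G m Ggen Gm; exact (rank_ge_kernels Ggen Gm).
(* One permutation is attached to each [theta] so that both the cycle and the transposition occur,
   which costs no extra generator. *)
have [s [[tc Ec] [tt Et]]] : exists s : {ffun J -> I} -> {perm I},
    (exists theta, s theta = cycle_perm n) /\ (exists theta, s theta = swap_perm n).
  pose c0 := [ffun _ : J => ord0 : I]; pose c1 := [ffun _ : J => ord_max : I].
  have [k0|k_gt0] := posnP k.
    (* There is a single [theta] here, but [n = 0], and on two points the cycle is the
       transposition. *)
    exists (fun=> cycle_perm n); split; exists c0 => //.
    have n0 : n = 0 by apply/eqP; rewrite -leqn0 leqNgt; apply/negP => n0; apply: nk.
    apply/permP => i; rewrite permE; apply: val_inj; move: i; rewrite n0.
    move=> i; case: tpermP => [->|->|] //.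
    by case: i => -[|[|//]] i ni0 ni1; [case: ni0|case: ni1]; apply: val_inj.
  exists (fun theta => if theta == c0 then cycle_perm n else swap_perm n).
  split; [exists c0|exists c1]; rewrite ?eqxx //; case: eqP => //.
  by move=> /ffunP/(_ (Ordinal k_gt0)); rewrite !ffunE => /(congr1 val).
pose g theta := rmap (s theta) (theta : {ffun J -> I}).
have gI : injective g.
  move=> theta eta /rmap_inj[_ E]; apply/ffunP => j.
  by rewrite (E (@perm_inj _ _)).
pose l := rmap (@collapse n) (fun=> ord0) ::
  [seq g theta | theta <- enum {ffun J -> I}].
have gl theta : In (rmap (s theta) (theta : {ffun J -> I})) l.
  right; apply/in_map_iff; exists theta; split=> //.
  by apply/InP; rewrite mem_enum.
exists (fun f => In f l); split.
  apply: generates_RegP.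
  - by move=> f [<-|/in_map_iff[theta [<- _]]]; apply/regularP; do 2 eexists.
  - by exists tc; rewrite -Ec.
  - by exists tt; rewrite -Et.
  - by exists (fun=> ord0); left.
  - move=> theta; exists (s (finfun theta)).
    by have := gl (finfun theta); rewrite (_ : finfun theta = theta :> (J -> I)) //;
      apply/funext => j; rewrite ffunE.
exists l; split; last first.
  by rewrite -[length l]/(size l) /= size_map -cardE card_ffun !card_ord.
constructor; last exact: NoDup_map_uniq gI (enum_uniq _).
move=> /in_map_iff[theta [/rmap_inj[E _] _]].
by apply: (@collapse_not_injective n); rewrite -E; exact: perm_inj.
Qed.

Lemma rank_full : 0 < n -> k = 0 -> rank_Reg_eq_nat A 3.
Proof.
move=> n0 k0; split; last by move=> G m Ggen Gm; exact (rank_ge3 Ggen n0 Gm).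
have theta0 (theta eta : J -> I) : theta = eta.
  by apply/funext => -[j jk]; have := jk; rewrite {1}k0.
pose th : J -> I := fun=> ord0.
pose l := [:: rmap (@collapse n) th; rmap (cycle_perm n) th; rmap (swap_perm n) th].
exists (fun f => In f l); split.
  apply: generates_RegP.
  - by move=> f [<-|[<-|[<-|//]]]; apply/regularP; do 2 eexists.
  - by exists th; right; left.
  - by exists th; right; right; left.
  - by exists th; left.
  - by move=> theta; exists (swap_perm n); rewrite (theta0 theta th);
      right; right; left.
exists l; split=> //.
have cNI := @collapse_not_injective n.
constructor=> [[/rmap_inj[E _]|[/rmap_inj[E _]|//]]|].
- by apply: cNI; rewrite -E; exact: perm_inj.
- by apply: cNI; rewrite -E; exact: perm_inj.
constructor=> [[/rmap_inj[E _]|//]|]; last by constructor=> //; constructor.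
(* The transposition sends 1 to 0 and the cycle sends it to 2, which differs from 0 modulo [n.+2] as
   [n] is positive. *)
have := congr1 (@^~ 1%R) E; rewrite tpermR permE => /(congr1 val) /=.
by rewrite !modn_small.
Qed.

End Coding.

Lemma coding (X : Type) (A : X -> Prop) n k :
  has_card A n -> has_card (fun x => ~ A x) k ->
  exists (d : 'I_n + 'I_k -> X) (c : X -> 'I_n + 'I_k),
    [/\ cancel d c, cancel c d, forall i, A (d (inl i)) & forall j, ~ A (d (inr j))].
Proof.
move=> /has_card_enum[a [aI aA]] /has_card_enum[b [bI bA]].
pose d s := match s with inl i => a i | inr j => b j end.
have Aa i : A (a i) by apply/aA; exists i.
have Ab j : ~ A (b j) by apply/bA; exists j.
have /choice[c cK] : forall x, exists s, d s = x.
  move=> x; have [/aA[i <-]|/bA[j <-]] := pselect (A x); first by exists (inl i).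
  by exists (inr j).
exists d, c; split=> // s; have := cK (d s).
case: s (c _) => [i|j] [i'|j'] /= E; [by rewrite (aI _ _ E)| | |by rewrite (bI _ _ E)].
  by have := Ab j'; rewrite E => /(_ (Aa i)).
by have := Ab j; rewrite -E => /(_ (Aa i')).
Qed.

Lemma rank_singleton (X : Type) (A : X -> Prop) :
  has_card A 1 -> rank_Reg_eq_nat A 1.
Proof.
move=> /has_card_enum[a [_ aA]]; pose f0 (_ : X) := a ord0.
have Aa : A (a ord0) by apply/aA; exists ord0.
have f0reg : regular_TXA A f0 by split=> [x|]; [|exists f0; split=> // x].
have regE f : regular_TXA A f -> f = f0.
  by move=> [fA _]; apply/funext => x; have [i <-] := proj1 (aA _) (fA x); rewrite ord1.
split=> [|G m [Greg Ggen] Gm].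
  exists (eq f0); split; last first.
    by exists [:: f0]; split; [constructor=> //; constructor|];
      split=> // u; split=> [|[]//]; left.
  by split=> [f <- //|f /regE->]; apply: gen_base.
have [g Gg] : exists g, G g by elim: (Ggen _ f0reg) => // g Gg; exists g.
by apply: (has_card_ge (s := [:: g]) Gm) => [|u [<-|]] //; constructor=> //; constructor.
Qed.

(** This turns [|A| = |X|] into [k = 0]: a duplicate-free list of [A] as long as one of [X] already
    contains every point. *)
Lemma has_card_compl0 (X : Type) (A : X -> Prop) n :
  has_card A n -> has_card (fun _ : X => True) n -> has_card (fun x => ~ A x) 0.
Proof.
move=> [l [l_nd [ln lA]]] [l' [l'_nd [l'n l'T]]].
exists [::]; split; [exact: NoDup_nil|split=> // x; split=> // NAx].
apply: NAx; apply/lA; apply: (NoDup_length_incl l_nd (l' := l')); last exact/l'T.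
  by rewrite ln l'n.
by move=> u _; apply/l'T.
Qed.

Lemma rank_finite_full (X : Type) (A : X -> Prop) n :
  le 3 n -> has_card A n -> has_card (fun _ : X => True) n -> rank_Reg_eq_nat A 3.
Proof.
case: n => [|[|n]] /leP // n0 An Xn.
have [d [c [dK cK dA dNA]]] := coding An (has_card_compl0 An Xn).
exact: (rank_full dK cK dA dNA).
Qed.

Lemma rank_finite (X : Type) (A : X -> Prop) n k :
  le 2 n -> has_card A n -> has_card (fun x => ~ A x) k -> ~ (le 3 n /\ k = 0) ->
  rank_Reg_eq_nat A (S (Nat.pow n k)).
Proof.
case: n => [|[|n]] /leP // _ An Ak nk.
have [d [c [dK cK dA dNA]]] := coding An Ak.
have -> : Nat.pow n.+2 k = n.+2 ^ k by elim: (k) => //= m ->; rewrite expnS.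
by apply: (rank_kernels dK cK dA dNA) => -[n0 k0]; apply: nk; split=> //; apply/leP.
Qed.

End Finite.

Theorem theorem5p24 (X : Type) (A : X -> Prop) (hA : exists a, A a) :
  (* |A| = 1 *)
  (has_card A 1 -> rank_Reg_eq_nat A 1) /\
  (* |A| >= 2 and X infinite *)
  ((exists a b, A a /\ A b /\ a <> b) -> ~ finite_type X -> rank_Reg_eq_pow2 A) /\
  (* 3 <= |A| = |X| finite *)
  (forall n, 3 <= n -> has_card A n -> has_card (fun _ : X => True) n ->
     rank_Reg_eq_nat A 3) /\
  (* otherwise: |A| = n >= 2, |X \ A| = k finite, not (n >= 3 and k = 0) *)
  (forall n k, 2 <= n -> has_card A n -> has_card (fun x => ~ A x) k ->
     ~ (3 <= n /\ k = 0) -> rank_Reg_eq_nat A (1 + n ^ k)).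
Proof.
split; [exact (@Finite.rank_singleton X A)|].
split; [exact (@Infinite.rank_infinite X A)|].
split; [exact (@Finite.rank_finite_full X A)|exact (@Finite.rank_finite X A)].
Qed.
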